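(* For every weighted digraph $\Gamma$ with Kirchhoff matrix $L$ and normalized matrix of maximum out forests $\bar J$, put $Z=L+\bar J^{T}$. Then the matrix $$L^{T}(ZZ^{T})^{-1}=L^{T}(\bar J^{T}\bar J+LL^{T})^{-1}$$ is the Moore-Penrose generalized inverse of $L$.
   Context: $\Gamma$ is a weighted digraph without loops with vertex set $\{1,\dots,n\}$, $n>1$; all arcs have strictly positive real weights; $\varepsilon_{ij}$ denotes the weight of the arc from $i$ to $j$, with $\varepsilon_{ij}=0$ if and only if there is no such arc. The Kirchhoff matrix $L=(\ell_{ij})$ is the $n\times n$ matrix with $\ell_{ij}=-\varepsilon_{ji}$ for $j\ne i$ and $\ell_{ii}=-\sum_{k\ne i}\ell_{ik}$. The superscript $T$ denotes transposition. A diverging forest is a digraph without (directed) circuits in which every vertex has indegree at most 1; its weak components are diverging trees, each having a unique vertex of indegree 0 (its root) from which all vertices of the tree are reachable. An out forest of $\Gamma$ is a spanning subgraph of $\Gamma$ that is a diverging forest; a maximum out forest is an out forest with the greatest possible number of arcs. The out forest dimension $v$ is the number of weak components of any maximum out forest, so maximum out forests have $n-v$ arcs. The weight of a subgraph is the product of the weights of its arcs (1 if it has no arcs); the weight $\varepsilon(\mathcal G)$ of a set of subgraphs is the sum of the weights of its elements (0 for the empty set). The normalized matrix of maximum out forests is $\bar J=(\bar J_{ij})$ with $\bar J_{ij}=\varepsilon(\mathcal F_{n-v}^{j\to i})/\varepsilon(\mathcal F_{n-v})$, where $\mathcal F_{n-v}$ is the set of maximum out forests and $\mathcal F_{n-v}^{j\to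 i}$ is the set of those in which $i$ belongs to a tree with root $j$. The Moore-Penrose generalized inverse of a matrix $A$ is the unique matrix $X$ with $AXA=A$, $XAX=X$, $(AX)^*=AX$, $(XA)^*=XA$. *)

(* Defs.v *)
From mathcomp Require Import all_boot all_order all_algebra.

Set Implicit Arguments.
Unset Strict Implicit.
Unset Printing Implicit Defensive.

Import Order.TTheory GRing.Theory Num.Theory.
Local Open Scope ring_scope.

(* Vertices are numbered from 0. [arc_weight G i j] is the weight of the arc
   from i to j, and is 0 exactly when there is no such arc. *)
Record wdigraph (R : realFieldType) (n : nat) := WDigraph {
  arc_weight : 'M[R]_n;
  arc_weight_ge0 : forall i j, 0 <= arc_weight i j;
  arc_weight_noloop : forall i, arc_weight i i = 0
}.

Section Forests.

Variables (R : realFieldType) (n : nat).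
Implicit Types (G : wdigraph R n) (F : {set 'I_n * 'I_n}).
Implicit Types (S : {set {set 'I_n * 'I_n}}).

Definition arcs G : {set 'I_n * 'I_n} := [set a | 0 < arc_weight G a.1 a.2].

(* The (i, j) entry involves the arc from j to i, so row i of the matrix
   collects the arcs entering i. *)
Definition kirchhoff G : 'M[R]_n :=
  \matrix_(i, j) if j != i then - arc_weight G j i
                 else - \sum_(k | k != i) - arc_weight G k i.

(* A spanning subgraph is identified with its set of arcs F, where (x, y) is
   the arc from x to y. *)
Definition arc_rel F : rel 'I_n := [rel x y | (x, y) \in F].

Definition indegree F (i : 'I_n) : nat := #|[set j | arc_rel F j i]|.

(* The vertices of a circuit are distinct, so their number is between 1 and n;
   see [circuit_freeP]. *)
Definition circuit_free F : bool :=
  [forall m : 'I_n, [forall c : m.+1.-tuple 'I_n, ~~ ucycleb (arc_rel F) c]].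

Lemma circuit_freeP F :
  reflect (forall c : seq 'I_n, c != [::] -> ~ ucycle (arc_rel F) c)
          (circuit_free F).
Proof.
apply: (iffP forallP) => [cF [//|x c] _ uc | cF m].
  have lt_cn : (size c < n)%N.
    have /andP[_ /card_uniqP /= <-] := uc.
    by rewrite -[leqRHS]card_ord max_card.
  have /forallP/(_ (in_tuple (x :: c))) := cF (Ordinal lt_cn).
  by move/negP; apply.
apply/forallP => c; apply/negP; apply: cF.
by rewrite -size_eq0 size_tuple.
Qed.

Definition diverging_forest F : bool :=
  circuit_free F && [forall i, (indegree F i <= 1)%N].

Definition out_forest G F : bool := (F \subset arcs G) && diverging_forest F.

Definition max_out_forests G : {set {set 'I_n * 'I_n}} :=
  [set F | out_forest G F &
           [forall F' : {set 'I_n * 'I_n}, out_forest G F' ==> (#|F'| <= #|F|)%N]].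

Definition same_weak_component F : rel 'I_n :=
  connect [rel x y | arc_rel F x y || arc_rel F y x].

Definition in_tree_rooted_at F (j i : 'I_n) : bool :=
  (indegree F j == 0%N) && same_weak_component F j i.

Definition max_out_forests_from G (j i : 'I_n) : {set {set 'I_n * 'I_n}} :=
  [set F in max_out_forests G | in_tree_rooted_at F j i].

Definition subgraph_weight G F : R := \prod_(a in F) arc_weight G a.1 a.2.

Definition set_weight G S : R := \sum_(F in S) subgraph_weight G F.

Definition Jbar G : 'M[R]_n :=
  \matrix_(i, j) (set_weight G (max_out_forests_from G j i) /
                  set_weight G (max_out_forests G)).

End Forests.

(* Over an ordered field the conjugate transpose is the transpose. *)
Definition is_moore_penrose (R : realFieldType) (m n : nat)
    (A : 'M[R]_(m, n)) (X : 'M[R]_(n, m)) : Prop :=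
  [/\ A *m X *m A = A, X *m A *m X = X,
      (A *m X)^T = A *m X & (X *m A)^T = X *m A].

Lemma moore_penrose_unique (R : realFieldType) (m n : nat)
    (A : 'M[R]_(m, n)) (X Y : 'M[R]_(n, m)) :
  is_moore_penrose A X -> is_moore_penrose A Y -> X = Y.
Proof.
case=> AXA XAX AXt XAt [AYA YAY AYt YAt].
have eAX : A *m X = A *m Y.
  by rewrite -AXt -[in LHS]AYA -mulmxA trmx_mul AXt AYt mulmxA AXA.
have eXA : X *m A = Y *m A.
  by rewrite -XAt -[in LHS]AYA -mulmxA mulmxA trmx_mul YAt XAt -mulmxA (mulmxA A) AXA.
by rewrite -XAX -mulmxA eAX mulmxA eXA YAY.
Qed.

(* Main.v *)
(** Let Q_k be the matrix whose (i, j) entry is the total weight of the forests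
    with k arcs in which i lies in the tree rooted at j, and s_k the total
    weight of all forests with k arcs. Sorting forests by what remains after
    deleting the arc entering i gives Q_(k+1) + L Q_k = s_(k+1) I. Hence every
    Q_k is a polynomial in L, and for the maximal k, where the next identity
    reads L Q_k = 0, the matrix J = Q_k / s_k satisfies L J = J L = 0 and
    I - J = L P for some P. The first fact makes L L^T and J^T J annihilate
    each other. The second makes M = L L^T + J^T J nonsingular: v M = 0 gives
    v L = 0 and J v^T = 0, so v v^T = v L P v^T = 0. *)

Require Import Defs.
From mathcomp Require Import all_boot all_order all_algebra.
Local Open Scope ring_scope.

Set Implicit Arguments.
Unset Strict Implicit.
Unset Printing Implicit Defensive.

Import Order.TTheory GRing.Theory Num.Theory.

(** * Reachability and roots in diverging forests, and the effect of adding an arc *)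

Section DigraphRoots.

Variable n : nat.
Implicit Types (F B : {set 'I_n * 'I_n}) (i j l x y z : 'I_n).

(** A path from the head of an arc back to its tail shortens to a simple one, which the arc closes
    to a circuit. *)
Lemma circuit_free_connectP F :
  reflect (forall x y, (x, y) \in F -> ~~ connect (arc_rel F) y x)
          (circuit_free F).
Proof.
apply: (iffP (circuit_freeP F)) => [cF x y xy | cF [//|x c] _].
  apply/negP => /connectP [p yp ex].
  case/shortenP: yp ex => p' yp' up' _ ex.
  apply: (cF (y :: p')) => //; apply/andP; split=> //.
  by rewrite /= rcons_path yp' -ex.
case/andP=> /=; rewrite rcons_path => /andP [xp lx] _.
by move: (cF _ _ lx); rewrite (introT connectP) //; exists c.
Qed.

Lemma indegree_eq0P F j :
  reflect (forall x, (x, j) \notin F) (indegree F j == 0%N).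
Proof.
rewrite /indegree cards_eq0; apply: (iffP eqP) => [e0 x | h].
  by have /setP/(_ x) := e0; rewrite !inE => /negbT.
by apply/setP => x; rewrite !inE; apply/negbTE/h.
Qed.

Lemma indegree_le1P F j :
  reflect (forall x y, (x, j) \in F -> (y, j) \in F -> x = y)
          (indegree F j <= 1)%N.
Proof.
apply: (iffP idP) => [/card_le1_eqP h x y xj yj | h].
  by apply/h; rewrite inE.
by apply/card_le1_eqP => x y; rewrite !inE => xj yj; apply: h.
Qed.

(** A path can skip everything between its first and last use of the new arc, so one use
    suffices. *)
Lemma connect_setU1 B l i x y :
  connect (arc_rel ((l, i) |: B)) x y =
  connect (arc_rel B) x y
  || (connect (arc_rel B) x l && connect (arc_rel B) i y).
Proof.
have sub u v : connect (arc_rel B) u v -> connect (arc_rel ((l, i) |: B)) u v.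
  by apply: connect_sub => a b ab; apply: connect1; apply: setU1r.
apply/idP/orP => [/connectP [p] | [/sub //| /andP[/sub xl /sub iy]]]; last first.
  by apply: connect_trans xl (connect_trans (connect1 _) iy); apply: setU11.
elim: p x => [|z p IHp] x /=; first by move=> _ ->; left.
case/andP=> /setU1P [[-> ez]|xz] zp ey.
  rewrite connect0 /=; case: (IHp z zp ey) => [|/andP[_ ->]]; last by right.
  by rewrite ez => ->; right.
have cxz : connect (arc_rel B) x z by apply: connect1.
case: (IHp z zp ey) => [zy | /andP[zl ->]].
  by left; apply: connect_trans zy.
by right; rewrite andbT; apply: connect_trans zl.
Qed.

Lemma connect_root F i j :
  indegree F i = 0%N -> connect (arc_rel F) j i -> j = i.
Proof.
move/eqP/indegree_eq0P => ri /connectP [p].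
elim/last_ind: p => [|p z _] //; rewrite rcons_path last_rcons => /andP[_ +] ez.
by rewrite -ez /arc_rel /= (negbTE (ri _)).
Qed.

(** The path from [j] to [x] is nonempty, since no arc enters [j]; its last arc must be the only arc
    entering [x], so it passes through [y]. *)
Lemma connect_root_arc F j x y :
  (indegree F x <= 1)%N -> indegree F j = 0%N ->
  connect (arc_rel F) j x -> (y, x) \in F -> connect (arc_rel F) j y.
Proof.
move=> /indegree_le1P dx /eqP/indegree_eq0P rj /connectP [p].
elim/last_ind: p => [_ /= ->|p z _]; first by rewrite (negbTE (rj _)).
rewrite rcons_path last_rcons => /andP[jp lz] ez; rewrite ez => yz.
rewrite ez in dx; rewrite (dx _ _ yz lz); apply/connectP; by exists p.
Qed.

Lemma connect_root_back F j x y :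
  (forall z, indegree F z <= 1)%N -> indegree F j = 0%N ->
  connect (arc_rel F) j x -> connect (arc_rel F) y x -> connect (arc_rel F) j y.
Proof.
move=> d1 rj jx /connectP [p]; elim: p y => [|z p IHp] y /=; first by move=> _ <-.
case/andP=> yz zp ex; apply: connect_root_arc (IHp _ zp ex) yz => //.
Qed.

Lemma connect_root_inj F i j x :
  (forall z, indegree F z <= 1)%N -> indegree F i = 0%N -> indegree F j = 0%N ->
  connect (arc_rel F) i x -> connect (arc_rel F) j x -> i = j.
Proof.
move=> d1 ri rj ix jx; apply/esym/(connect_root ri).
exact: connect_root_back ix.
Qed.

(** Along an undirected walk from the root, forward arcs extend the directed path and backward arcs
    retrace it. *)
Lemma in_tree_rooted_atE F j i :
  (forall z, indegree F z <= 1)%N ->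
  in_tree_rooted_at F j i = (indegree F j == 0%N) && connect (arc_rel F) j i.
Proof.
move=> d1; rewrite /in_tree_rooted_at; case: eqP => //= rj.
apply/idP/idP; last first.
  by apply: connect_sub => x y xy; apply: connect1; rewrite /= xy.
case/connectP=> p; elim/last_ind: p i => [|p z IHp] i /=; first by move=> _ ->.
rewrite rcons_path last_rcons => /andP[jp +] ->.
have {IHp} := IHp _ jp erefl; set y := last j p => jy /orP [yz | zy].
  by apply: connect_trans jy (connect1 _).
exact: connect_root_arc jy zy.
Qed.

Lemma diverging_forest_indegree F z : diverging_forest F -> (indegree F z <= 1)%N.
Proof. by case/andP => _ /forallP. Qed.

(** Any circuit created uses the new arc, so it needs a path from [i] to [l]; the bound on indegrees
    survives because [i] was a root. *)
Lemma diverging_forest_setU1 B l i :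
  indegree B i = 0%N ->
  diverging_forest ((l, i) |: B) =
  diverging_forest B && ~~ connect (arc_rel B) i l.
Proof.
move=> /eqP/indegree_eq0P ri; apply/idP/idP.
  case/andP=> /circuit_free_connectP cF /forallP dF.
  apply/andP; split; last first.
    have := cF l i; rewrite !inE eqxx => /(_ isT).
    by rewrite connect_setU1 negb_or => /andP[].
  apply/andP; split.
    apply/circuit_free_connectP => x y xy.
    have := cF x y; rewrite !inE xy orbT => /(_ isT).
    by rewrite connect_setU1 negb_or => /andP[].
  apply/forallP => z; apply/indegree_le1P => x y xz yz.
  by apply: (elimT (indegree_le1P _ _) (dF z)); rewrite !inE ?xz ?yz orbT.
case/andP=> /andP[/circuit_free_connectP cB /forallP dB] il.
apply/andP; split.
  apply/circuit_free_connectP => x y; rewrite connect_setU1 negb_or.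
  rewrite !inE => /orP[/eqP[-> ->]|xy]; first by rewrite (negbTE il).
  rewrite cB //=; apply/negP => /andP[yl ix]; case/negP: il.
  apply: connect_trans ix (connect_trans _ yl); exact: connect1.
apply/forallP => z; apply/indegree_le1P => x y.
rewrite !inE => /orP[/eqP[-> ->]|xz] /orP[/eqP[-> //]|yz].
- by rewrite (negbTE (ri _)) in yz.
- by move=> ez; rewrite ez (negbTE (ri _)) in xz.
- exact: (elimT (indegree_le1P _ _) (dB z)).
Qed.

Lemma indegree_setU1_eq0 B l i j :
  (indegree ((l, i) |: B) j == 0%N) = (j != i) && (indegree B j == 0%N).
Proof.
apply/indegree_eq0P/andP => [h|[ji /indegree_eq0P h] x].
  split; first by apply/eqP => ji; have := h l; rewrite !inE ji eqxx.
  by apply/indegree_eq0P => x; have := h x; rewrite !inE negb_or => /andP[].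
by rewrite !inE negb_or h andbT xpair_eqE (negbTE ji) andbF.
Qed.

Lemma in_tree_rooted_at_connect B i j x :
  diverging_forest B -> indegree B i = 0%N -> connect (arc_rel B) i x ->
  in_tree_rooted_at B j x = (i == j).
Proof.
move=> fB ri ix; have d1 z := diverging_forest_indegree z fB.
rewrite in_tree_rooted_atE //; apply/andP/eqP => [[/eqP rj jx]|<-].
  exact: connect_root_inj ix jx.
by rewrite ri.
Qed.

(** The new arc grafts the tree of [i] onto the tree of [l]: the vertices below [i] take the root of
    [l], and all others keep theirs. *)
Lemma in_tree_rooted_at_setU1 B l i j x :
  diverging_forest B -> indegree B i = 0%N -> ~~ connect (arc_rel B) i l ->
  in_tree_rooted_at ((l, i) |: B) j x =
  if connect (arc_rel B) i x then in_tree_rooted_at B j l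
  else in_tree_rooted_at B j x.
Proof.
move=> fB ri il.
have fF : diverging_forest ((l, i) |: B) by rewrite diverging_forest_setU1 // fB.
have dB z := diverging_forest_indegree z fB.
have dF z := diverging_forest_indegree z fF.
rewrite !in_tree_rooted_atE // indegree_setU1_eq0 connect_setU1.
case: (boolP (connect _ i x)) => ix; rewrite ?andbF ?andbT ?orbF.
  case: (eqVneq j i) => [->|ji] /=; first by rewrite (negbTE il) andbF.
  case: eqP => //= rj; case: (boolP (connect _ j x)) => //= jx.
  by case/eqP: ji; apply: connect_root_inj jx ix.
by case: (eqVneq j i) => [->|ji] //=; rewrite (negbTE ix) andbF.
Qed.

(* A forest in which [i] is not a root arises uniquely by adding an arc from
   [l] to [i] to a forest with root [i], where [l] is outside the tree of [i]. *)
Lemma sum_diverging_forest (V : nmodType) (i : 'I_n) k (g : _ -> V) :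
  \sum_(F | diverging_forest F && (#|F| == k)) g F =
  \sum_(B | [&& diverging_forest B, indegree B i == 0%N & #|B| == k]) g B +
  \sum_(B | [&& diverging_forest B, indegree B i == 0%N & #|B|.+1 == k])
    \sum_(l | ~~ connect (arc_rel B) i l) g ((l, i) |: B).
Proof.
(* As [i] has indegree 0 or 1, exactly one of the two summands equals [g F], and the other is 0. *)
have step F : diverging_forest F && (#|F| == k) ->
    g F = (if indegree F i == 0%N then g F else 0) + \sum_(l | (l, i) \in F) g F.
  case/andP => /(diverging_forest_indegree i) + _.
  have -> : \sum_(l | (l, i) \in F) g F = g F *+ indegree F i.
    by rewrite -sumr_const; apply: eq_bigl => l; rewrite inE.
  by case: (indegree F i) => [|[|]] // _; rewrite ?addr0 ?add0r.
rewrite (eq_bigr _ step) big_split /=; congr (_ + _).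
  rewrite -big_mkcondr /=; apply: eq_bigl => F.
  by rewrite -andbA; congr andb; rewrite andbC.
rewrite (exchange_big_dep predT) //= [RHS](exchange_big_dep predT) //=.
apply: eq_bigr => l _.
rewrite (reindex_onto (fun B => (l, i) |: B) (fun F => F :\ (l, i))) /=; last first.
  by move=> F /andP[_ lF]; rewrite setD1K.
apply: eq_bigl => B; rewrite !inE eqxx andbT.
case: (boolP ((l, i) \in B)) => lB.
  have -> : ((l, i) |: B) :\ (l, i) == B = false.
    by apply/eqP => /setP/(_ (l, i)); rewrite !inE eqxx lB.
  have -> : (indegree B i == 0%N) = false.
    by apply/indegree_eq0P => /(_ l); rewrite lB.
  by rewrite !andbF.
rewrite setU1K // eqxx andbT cardsU1 lB add1n.
case: (boolP (indegree B i == 0%N)) => [/eqP ri|ri].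
  by rewrite diverging_forest_setU1 //= andbAC.
(* When [i] is not a root of [B], the new arc would be a second one entering [i]. *)
rewrite andbF /=; apply/negbTE; rewrite negb_and; apply/orP; left.
apply: contra ri => fF; apply/indegree_eq0P => x; apply/negP => xi.
have /indegree_le1P/(_ x l) := diverging_forest_indegree i fF.
rewrite !inE eqxx xi orbT => /(_ isT isT) ex.
by rewrite -ex xi in lB.
Qed.

End DigraphRoots.

(** * Weighted forest sums and their recurrence under the Kirchhoff matrix *)

Section ForestMatrices.

Variables (R : realFieldType) (n : nat) (G : wdigraph R n).
Implicit Types (F B : {set 'I_n * 'I_n}) (i j l x : 'I_n).

Local Notation w := (subgraph_weight G).
Local Notation e := (arc_weight G).
Local Notation L := (kirchhoff G).

(* These sums may run over all diverging forests: a forest with an arc outside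
   [G] has weight 0. *)
Definition forest_total k : R :=
  \sum_(F | diverging_forest F && (#|F| == k)) w F.

Definition forest_mx k : 'M[R]_n :=
  \matrix_(i, j)
    \sum_(F | diverging_forest F && (#|F| == k)) w F * (in_tree_rooted_at F j i)%:R.

Lemma subgraph_weight_setU1 B l i :
  indegree B i = 0%N -> w ((l, i) |: B) = e l i * w B.
Proof. by move/eqP/indegree_eq0P => ri; rewrite /subgraph_weight big_setU1. Qed.

(** The rows of [L] sum to zero, so only differences between rows of [A] matter. *)
Lemma mul_kirchhoffE p (A : 'M[R]_(n, p)) i (j : 'I_p) :
  (L *m A) i j = \sum_l e l i * (A i j - A l j).
Proof.
rewrite mxE (bigD1 i) //= [RHS](bigD1 i) //= subrr mulr0 add0r.
rewrite mxE eqxx /= sumrN opprK mulr_suml -big_split /=.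
by apply: eq_bigr => l li; rewrite mxE li mulNr mulrBr.
Qed.

Lemma forest_mxE i k x j :
  forest_mx k x j =
  \sum_(B | [&& diverging_forest B, indegree B i == 0%N & #|B| == k])
    w B * (in_tree_rooted_at B j x)%:R +
  \sum_(B | [&& diverging_forest B, indegree B i == 0%N & #|B|.+1 == k])
    w B * \sum_(l | ~~ connect (arc_rel B) i l) e l i *
      (if connect (arc_rel B) i x then in_tree_rooted_at B j l
       else in_tree_rooted_at B j x)%:R.
Proof.
rewrite mxE (sum_diverging_forest i); congr (_ + _).
apply: eq_bigr => B /and3P[fB /eqP ri _]; rewrite mulr_sumr; apply: eq_bigr => l il.
by rewrite subgraph_weight_setU1 // in_tree_rooted_at_setU1 // mulrCA mulrA.
Qed.

Lemma forest_totalE i k :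
  forest_total k =
  \sum_(B | [&& diverging_forest B, indegree B i == 0%N & #|B| == k]) w B +
  \sum_(B | [&& diverging_forest B, indegree B i == 0%N & #|B|.+1 == k])
    w B * \sum_(l | ~~ connect (arc_rel B) i l) e l i.
Proof.
rewrite /forest_total (sum_diverging_forest i); congr (_ + _).
apply: eq_bigr => B /and3P[fB /eqP ri _]; rewrite mulr_sumr; apply: eq_bigr => l il.
by rewrite subgraph_weight_setU1 // mulrC.
Qed.

(* The forests in which [i] is not a root do not contribute: exchanging the arc
   entering [i] with the arc coming from [L] changes the sign. *)
Lemma kirchhoff_forest_mxE i j k :
  (L *m forest_mx k) i j =
  \sum_(B | [&& diverging_forest B, indegree B i == 0%N & #|B| == k])
    w B * \sum_(l | ~~ connect (arc_rel B) i l)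
      e l i * ((i == j)%:R - (in_tree_rooted_at B j l)%:R).
Proof.
rewrite mul_kirchhoffE.
under eq_bigr => l _ do
  rewrite !(forest_mxE i) opprD addrACA -!sumrB mulrDr !mulr_sumr.
rewrite big_split /= [X in _ + X]exchange_big /= [X in _ + X]big1 ?addr0.
  rewrite exchange_big /=; apply: eq_bigr => B /and3P[fB /eqP ri _].
  rewrite mulr_sumr [RHS]big_mkcond; apply: eq_bigr => l _.
  rewrite (in_tree_rooted_at_connect j fB ri (connect0 _ i)) -mulrBr mulrCA.
  case: (boolP (connect _ i l)) => //= il.
  by rewrite (in_tree_rooted_at_connect j fB ri il) subrr !mulr0.
move=> B _; under eq_bigr => l _ do rewrite -mulrBr -sumrB mulrCA.
rewrite -mulr_sumr; apply/eqP; rewrite mulf_eq0; apply/orP; right; apply/eqP.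
(* Vertices [l] below [i] always share the root of [i], so their differences vanish; the sum over
   the other [l] cancels by symmetry. *)
rewrite connect0 (bigID (fun l => connect (arc_rel B) i l)) /=.
rewrite big1 ?add0r => [|l il]; last by rewrite big1 ?mulr0 // => m _; rewrite il subrr.
set C := fun l => ~~ connect (arc_rel B) i l.
pose d l : R := (in_tree_rooted_at B j l)%:R.
have -> : \sum_(l | C l) e l i * (\sum_(m | C m) (e m i * d m -
   e m i * (if connect (arc_rel B) i l then in_tree_rooted_at B j m
            else in_tree_rooted_at B j l)%:R)) =
  \sum_(l | C l) \sum_(m | C m) e l i * e m i * d m -
  \sum_(l | C l) \sum_(m | C m) e l i * e m i * d l.
  rewrite -sumrB; apply: eq_bigr => l il; rewrite mulr_sumr -sumrB.
  by apply: eq_bigr => m _; rewrite (negbTE il) mulrBr !mulrA.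
apply/eqP; rewrite subr_eq0 exchange_big /=; apply/eqP.
by apply: eq_bigr => l _; apply: eq_bigr => m _; rewrite (mulrC (e l i)).
Qed.

(** The indicators of the tree of [l] cancel between the two summands. What remains is [(i == j)%:R]
    times the total weight, split by whether [i] is a root. *)
Lemma forest_mxS k : forest_mx k.+1 + L *m forest_mx k = (forest_total k.+1)%:M.
Proof.
apply/matrixP => i j; rewrite mxE kirchhoff_forest_mxE (forest_mxE i) [RHS]mxE.
rewrite -addrA -big_split /= -[RHS]mulr_natr (forest_totalE i) mulrDl !mulr_suml.
congr (_ + _); apply: eq_bigr => B /and3P[fB /eqP ri _].
  by rewrite (in_tree_rooted_at_connect j fB ri (connect0 _ i)).
rewrite -mulrDr -mulrA -big_split mulr_suml; congr (_ * _).
by apply: eq_bigr => l _; rewrite connect0 /= -mulrDr addrC subrK.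
Qed.

Lemma diverging_forest0 : diverging_forest (set0 : {set 'I_n * 'I_n}).
Proof.
apply/andP; split; first by apply/circuit_free_connectP => x y; rewrite inE.
by apply/forallP => x; apply/indegree_le1P => y z; rewrite inE.
Qed.

Lemma forest_mx0 : forest_mx 0 = (forest_total 0)%:M.
Proof.
apply/matrixP => i j; rewrite (forest_mxE i) [RHS]mxE -[RHS]mulr_natr (forest_totalE i).
rewrite [X in _ + X]big_pred0 1?[X in (_ + X) * _]big_pred0 => [|B|B]; try by rewrite !andbF.
rewrite !addr0 mulr_suml; apply: eq_bigr => B /and3P[fB /eqP ri _].
by rewrite (in_tree_rooted_at_connect j fB ri (connect0 _ i)).
Qed.

(** Commutation of [P] with [L] stands in for being a polynomial in [L]; by the recurrence, the
    preceding forest matrix serves as the next [P]. *)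
Lemma forest_mx_polynomial k :
  exists2 P : 'M[R]_n, L *m P = P *m L & forest_mx k = (forest_total k)%:M - L *m P.
Proof.
elim: k => [|k [P LP eP]]; first by exists 0; rewrite ?mul0mx ?mulmx0 // subr0 forest_mx0.
exists (forest_mx k); last by rewrite -forest_mxS addrK.
by rewrite eP mulmxBr mulmxBl scalar_mxC -!mulmxA LP.
Qed.

(** * Maximum out forests and the matrix [Jbar] *)

Lemma subgraph_weight_gt0 F : F \subset arcs G -> 0 < w F.
Proof. by move/subsetP => sF; apply: prodr_gt0 => a /sF; rewrite inE. Qed.

Lemma subgraph_weight_eq0 F : ~~ (F \subset arcs G) -> w F = 0.
Proof.
case/subsetPn => a aF; rewrite inE => na; apply/eqP/prodf_eq0; exists a => //.
by move: na; rewrite lt_neqAle arc_weight_ge0 andbT negbK eq_sym.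
Qed.

Lemma sum_forest_arcs k (f : _ -> R) :
  \sum_(F | diverging_forest F && (#|F| == k)) w F * f F =
  \sum_(F | out_forest G F && (#|F| == k)) w F * f F.
Proof.
rewrite (bigID (fun F => F \subset arcs G)) /= [X in _ + X]big1 ?addr0.
  by apply: eq_bigl => F; rewrite /out_forest [LHS]andbC andbA.
by move=> F /andP[_ /subgraph_weight_eq0->]; rewrite mul0r.
Qed.

(** This makes the maximum out forests a level set of the arc count, so that [Jbar] becomes a
    normalized [forest_mx m]. *)
Lemma max_out_forests_card : exists m,
  [/\ exists2 F, out_forest G F & #|F| = m,
      forall F, out_forest G F -> (#|F| <= m)%N
    & forall F, (F \in max_out_forests G) = out_forest G F && (#|F| == m)].
Proof.
have f0 : out_forest G set0 by rewrite /out_forest sub0set diverging_forest0.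
case: (@arg_maxnP _ set0 (out_forest G) (fun F => #|F|) f0) => M fM maxM.
exists #|M|; split=> [|//|F]; first by exists M.
rewrite inE; case: (boolP (out_forest G F)) => //= fF.
apply/forallP/eqP => [h|-> F']; last by apply/implyP => /maxM.
apply/eqP; rewrite eqn_leq (implyP (h M) fM) andbT; exact: maxM.
Qed.

Lemma JbarP :
  [/\ L *m Jbar G = 0, Jbar G *m L = 0 & exists P, 1%:M - Jbar G = L *m P].
Proof.
have [m [[M fM cM] maxm inM]] := max_out_forests_card.
have totE k : forest_total k = \sum_(F | out_forest G F && (#|F| == k)) w F.
  have := sum_forest_arcs k (fun=> 1).
  by under eq_bigr => F _ do rewrite mulr1; under [RHS]eq_bigr => F _ do rewrite mulr1.
have noS F : out_forest G F && (#|F| == m.+1) = false.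
  by apply/negP => /andP[/maxm le_Fm /eqP cF]; rewrite cF ltnn in le_Fm.
have tot_gt0 : 0 < forest_total m.
  rewrite totE (bigD1 M) ?fM ?cM //= ltr_pwDl //.
    by apply: subgraph_weight_gt0; case/andP: fM.
  apply: sumr_ge0 => F /andP[/andP[/andP[sF _] _] _].
  exact/ltW/subgraph_weight_gt0.
have tot0 : forest_total m != 0 by rewrite gt_eqF.
have JE : Jbar G = (forest_total m)^-1 *: forest_mx m.
  apply/matrixP => i j; rewrite !mxE mulrC; congr (_^-1 * _).
    by rewrite /set_weight totE; apply: eq_bigl => F; rewrite inM.
  rewrite sum_forest_arcs /set_weight [LHS](eq_bigl
    (fun F => out_forest G F && (#|F| == m) && in_tree_rooted_at F j i)).
    rewrite big_mkcondr; apply: eq_bigr => F _.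
    by case: ifP; rewrite ?mulr1 ?mulr0.
  by move=> F; rewrite inE inM.
(* No out forest has [m.+1] arcs, so both [forest_mx m.+1] and [forest_total m.+1] vanish in the
   recurrence. *)
have LQ : L *m forest_mx m = 0.
  have := forest_mxS m; rewrite totE big_pred0 // raddf0.
  suff -> : forest_mx m.+1 = 0 by rewrite add0r => ->.
  by apply/matrixP => i j; rewrite !mxE sum_forest_arcs big_pred0.
have [P LP QE] := forest_mx_polynomial m.
rewrite JE; split.
- by rewrite -scalemxAr LQ scaler0.
- rewrite -scalemxAl.
  suff -> : forest_mx m *m L = L *m forest_mx m by rewrite LQ scaler0.
  by rewrite QE mulmxBr mulmxBl scalar_mxC -!mulmxA LP.
- exists ((forest_total m)^-1 *: P).
  rewrite QE scalerBr scale_scalar_mx mulVf // opprB addrC subrK.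
  by rewrite scalemxAr.
Qed.

End ForestMatrices.

(** * Sums of Gram matrices and the Moore-Penrose inverse *)

Section MoorePenrose.

Variable R : realFieldType.

Lemma mulmx_tr_ge0 n (u : 'rV[R]_n) : 0 <= (u *m u^T) 0 0.
Proof. by rewrite mxE; apply: sumr_ge0 => i _; rewrite mxE -expr2 sqr_ge0. Qed.

Lemma mulmx_tr_eq0 n (u : 'rV[R]_n) : (u *m u^T) 0 0 = 0 -> u = 0.
Proof.
rewrite mxE => /eqP; rewrite psumr_eq0 => [/allP h|i _]; last first.
  by rewrite mxE -expr2 sqr_ge0.
apply/rowP => i; rewrite [RHS]mxE; apply/eqP.
by have := h i (mem_index_enum i); rewrite mxE mulf_eq0 orbb.
Qed.

Lemma gram_add_unitmx n (A B P : 'M[R]_n) :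
  1%:M - B = A *m P -> B^T *m B + A *m A^T \in unitmx.
Proof.
move=> BP; rewrite -row_free_unit; apply: inj_row_free => v vM.
(* This is [v *m M *m v^T], a sum of two nonnegative squares, so both vanish. *)
have : (v *m B^T) *m (v *m B^T)^T + (v *m A) *m (v *m A)^T = 0.
  rewrite !trmx_mul !trmxK -!mulmxA -!mulmxDr.
  by rewrite (mulmxA B^T) (mulmxA A) -mulmxDl mulmxA vM mul0mx.
move/matrixP/(_ 0 0); rewrite mxE [RHS]mxE.
move/eqP; rewrite paddr_eq0 ?mulmx_tr_ge0 // => /andP[/eqP vB /eqP vA].
have {}vB := mulmx_tr_eq0 vB; have {}vA := mulmx_tr_eq0 vA.
have Bv : B *m v^T = 0 by rewrite -[B]trmxK -trmx_mul vB trmx0.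
apply: mulmx_tr_eq0.
have -> : v^T = A *m P *m v^T by rewrite -BP mulmxBl mul1mx Bv subr0.
by rewrite !mulmxA vA !mul0mx mxE.
Qed.

(** Since [B *m A = 0], [M] acts on [A] as [A *m A^T] does. Hence the symmetric [invmx M] commutes
    with [A *m A^T], which makes [A *m X] symmetric for the proposed inverse [X]. *)
Lemma gram_add_moore_penrose n (A B : 'M[R]_n) :
  B *m A = 0 -> B^T *m B + A *m A^T \in unitmx ->
  is_moore_penrose A (A^T *m invmx (B^T *m B + A *m A^T)).
Proof.
set M := B^T *m B + A *m A^T => BA uM.
have AtBt : A^T *m B^T = 0 by rewrite -trmx_mul BA trmx0.
have Mt : (invmx M)^T = invmx M.
  by rewrite trmx_inv /M linearD /= !trmx_mul !trmxK.
have MA : M *m A = A *m A^T *m A by rewrite mulmxDl -mulmxA BA mulmx0 add0r.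
have AM : A^T *m M = A^T *m A *m A^T by rewrite mulmxDr !mulmxA AtBt mul0mx add0r.
have comm : A *m A^T *m invmx M = invmx M *m A *m A^T.
  have h : M *m (A *m A^T) = A *m A^T *m M by rewrite mulmxA MA -!mulmxA AM !mulmxA.
  by rewrite -{1}(mulKmx uM (A *m A^T)) h mulmxA mulmxK // mulmxA.
have AMA : A *m A^T *m invmx M *m A = A.
  by rewrite comm -!mulmxA (mulmxA A) -MA mulKmx.
have AtMA : A^T *m invmx M *m A *m A^T = A^T.
  apply: trmx_inj; rewrite !trmx_mul !trmxK Mt !mulmxA; exact: AMA.
split.
- by rewrite !mulmxA.
- by rewrite !mulmxA AtMA.
- by rewrite !trmx_mul trmxK Mt !mulmxA -comm.
- by rewrite !trmx_mul trmxK Mt !mulmxA.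
Qed.

End MoorePenrose.

Theorem theorem12 (R : realFieldType) (n : nat) (hn : (1 < n)%N)
    (G : wdigraph R n) :
  let L := kirchhoff G in
  let J := Jbar G in
  let Z := L + J^T in
  [/\ Z *m Z^T \in unitmx,
      J^T *m J + L *m L^T \in unitmx,
      L^T *m invmx (Z *m Z^T) = L^T *m invmx (J^T *m J + L *m L^T)
    & is_moore_penrose L (L^T *m invmx (Z *m Z^T))].
Proof.
move=> L J Z; have [LJ JL [P JP]] := JbarP G.
(* The cross terms are [L *m J] and its transpose, both zero. *)
have -> : Z *m Z^T = J^T *m J + L *m L^T.
  rewrite /Z [(L + _)^T]linearD /= trmxK mulmxDr !mulmxDl LJ add0r.
  by rewrite -trmx_mul LJ trmx0 addr0 addrC.
have uM := gram_add_unitmx JP.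
by split=> //; apply: gram_add_moore_penrose.
Qed.
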